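(* Let $\alpha>-1$, $\xi\le0$ and $M\ge0$. Let $c_0$ be the linear functional associated to $x^{\alpha}e^{-x}dx$ on $]0,+\infty[$, and $c_1$ the one associated to $\frac{x^{\alpha+1}}{x-\xi}e^{-x}dx+M\delta(\xi)$, where the first part is supported on $]0,+\infty[$. Let $T_n(x,\xi,M)$ be the monic polynomials orthogonal with respect to $c_1$. The square norm $\hat k_n=c_1(T_n(x,\xi,M)^2)$ and the coefficient $\sigma_n$ of the coherence relation are given by $$\hat k_0=c_1(1),\qquad \hat k_n=-k_{n-1}^{\alpha+1}\,\frac{c_1(L_n^{\alpha+1}(x))}{c_1(L_{n-1}^{\alpha+1}(x))}\quad(n\ge1),$$ $$\sigma_n=\frac{c_1(L_n^{\alpha+1}(x))}{c_1(L_{n-1}^{\alpha+1}(x))}\quad(n\ge1).$$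
   Context: $\delta(\xi)$ is the Dirac measure at $\xi$, so $c_1(p)=\int_0^\infty p(x)\frac{x^{\alpha+1}}{x-\xi}e^{-x}dx+Mp(\xi)$. For $a>-1$, $L_n^{a}$ is the monic Laguerre-Sonin polynomial of degree $n$, orthogonal with respect to $x^{a}e^{-x}dx$ on $]0,+\infty[$, and $k_n^{a}=\int_0^\infty(L_n^{a}(x))^2x^{a}e^{-x}dx=n!\,\Gamma(n+a+1)$. The pair $(c_0,c_1)$ is coherent: $\sigma_n$ ($n\ge1$) is the real number such that $T_n=\frac{P_{n+1}'}{n+1}-\sigma_n\frac{P_n'}{n}$ with $P_n=L_n^{\alpha}$ the monic orthogonal polynomials for $c_0$; equivalently $T_n(x,\xi,M)=L_n^{\alpha+1}(x)-\sigma_nL_{n-1}^{\alpha+1}(x)$. *)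

(* Defs.v *)
From HB Require Import structures.
From mathcomp Require Export all_boot all_order all_algebra.
From mathcomp Require Export all_classical all_reals all_analysis.
Export Order.TTheory GRing.Theory Num.Theory.
Export numFieldNormedType.Exports.

Set Implicit Arguments.
Unset Strict Implicit.
Unset Printing Implicit Defensive.

Local Open Scope classical_set_scope.
Local Open Scope ring_scope.

Section LaguerreSobolev.
Context {R : realType}.
Implicit Types (a alpha xi M s : R) (c : {poly R} -> R) (P T : nat -> {poly R}).

(* Rintegral is total; the integrand is integrable exactly when a > -1 for
   every p with p(0) != 0, and only a > -1 is meant to be used. *)
Definition laguerre_functional a (p : {poly R}) : R :=
  \int[lebesgue_measure]_(x in `]0, +oo[) (p.[x] * (x `^ a * expR (- x))).

(* For xi = 0 the denominator does not vanish on ]0, +oo[. *)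
Definition modified_functional alpha xi M (p : {poly R}) : R :=
  \int[lebesgue_measure]_(x in `]0, +oo[)
    (p.[x] * (x `^ (alpha + 1) / (x - xi) * expR (- x)))
  + M * p.[xi].

(* Monic, P n of degree n, pairwise orthogonal. This determines P uniquely when
   c is positive definite, so no condition on c (P n ^+ 2) is imposed. *)
Definition monic_orthogonal c P : Prop :=
  (forall n, P n \is monic /\ size (P n) = n.+1) /\
  (forall m n, m <> n -> c (P m * P n) = 0).

Definition sqnorm c P (n : nat) : R := c (P n ^+ 2).

(* Meaningful for n >= 1 only. *)
Definition coherence_coef P T (n : nat) s : Prop :=
  T n = (n.+1%:R)^-1 *: (P n.+1)^`() - s *: ((n%:R)^-1 *: (P n)^`()).

End LaguerreSobolev.

(* Main.v *)
Require Import Defs.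
From mathcomp Require Import measurable_realfun.
From mathcomp Require Import ring lra.

(* Since [c1 ((x - xi) p) = c (p)], where [c] is the Laguerre functional with
   parameter [alpha + 1], the polynomial
   [P_n - (c1 (P_n) / c1 (P_(n-1))) P_(n-1)], with [P_n] the monic orthogonal
   polynomials of [c], is [c1]-orthogonal both to the constants and to
   [(x - xi) r] for [deg r < n - 1], hence equals [T_n]. Then
   [c1 (T_n^2) = c1 (T_n (x - xi) P_(n-1)) = c (T_n P_(n-1))] gives the norm.
   The coherence relation follows because the derivatives of the Laguerre
   polynomials are again Laguerre polynomials, which by integration by parts
   only requires [Gamma (a + 2) = (a + 1) Gamma (a + 1)]. *)

Set Implicit Arguments.
Unset Strict Implicit.
Unset Printing Implicit Defensive.

Local Open Scope ring_scope.

(** * Monic orthogonal polynomials of a positive definite functional *)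

Section OrthogonalPolynomials.
Context {R : realType}.
Implicit Types (c : {poly R} -> R) (P : nat -> {poly R}) (p q r : {poly R}).

Definition positive_definite c : Prop := forall p, p != 0 -> 0 < c (p ^+ 2).

Lemma functionalD c p q : scalar c -> c (p + q) = c p + c q.
Proof. by move=> lc; have := lc 1 p q; rewrite scale1r mul1r. Qed.

Lemma functional0 c : scalar c -> c 0 = 0.
Proof. by move=> lc; have := functionalD 0 0 lc; rewrite addr0; lra. Qed.

Lemma functionalZ c a p : scalar c -> c (a *: p) = a * c p.
Proof. by move=> lc; have := lc a p 0; rewrite functional0// !addr0. Qed.

Lemma functionalB c p q : scalar c -> c (p - q) = c p - c q.
Proof.
move=> lc; rewrite functionalD// -scaleN1r functionalZ//; ring.
Qed.

(** The right-hand form turns degree and monicity checks into coefficient computations, which behave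
    well under sums and scaling. *)
Lemma monic_sizeP n p :
  (p \is monic /\ size p = n.+1) <-> ((size p <= n.+1)%N /\ p`_n = 1).
Proof.
split=> [[/monicP pm sp]|[sp pn]].
  by rewrite sp leqnn; split => //; move: pm; rewrite lead_coefE sp.
have sE : size p = n.+1.
  apply/eqP; rewrite eqn_leq sp ltnNge; apply/negP => sn.
  by move/eqP: pn; rewrite nth_default// eq_sym oner_eq0.
by split => //; apply/monicP; rewrite lead_coefE sE.
Qed.

Lemma size_sub_top n p q : (size p <= n.+1)%N -> (size q <= n.+1)%N ->
  p`_n = q`_n -> (size (p - q)%R <= n)%N.
Proof.
move=> sp sq pq; apply/leq_sizeP => j; rewrite leq_eqVlt => /predU1P[<-|nj].
  by rewrite coefB pq subrr.
by rewrite coefB !nth_default ?subrr//; exact: leq_trans nj.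
Qed.

Lemma monic_orthogonal_lower c P n q : scalar c -> monic_orthogonal c P ->
  (size q <= n)%N -> c (P n * q) = 0.
Proof.
move=> lc [mP oP]; suff H m : (m <= n)%N -> forall q, (size q <= m)%N ->
  c (P n * q) = 0 by exact: H.
elim: m => [_ {}q|m IH mn {}q sq].
  by rewrite leqn0 size_poly_eq0 => /eqP ->; rewrite mulr0 functional0.
have [sP Pm] := (monic_sizeP _ _).1 (mP m).
rewrite -(subrK (q`_m *: P m) q) mulrDr functionalD// -scalerAr functionalZ//.
rewrite IH ?(ltnW mn)// ?oP ?mulr0 ?addr0//; first by move=> E; rewrite E ltnn in mn.
apply: size_sub_top => //; last by rewrite coefZ Pm mulr1.
exact: leq_trans (size_scale_leq _ _) sP.
Qed.

(** The leading terms cancel in [p - P n], so both [p] and [P n] are orthogonal to it. Hence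
    [c ((p - P n) ^+ 2) = 0], and positive definiteness concludes. *)
Lemma monic_orthogonal_unique c P n p : scalar c -> positive_definite c ->
  monic_orthogonal c P -> p \is monic /\ size p = n.+1 ->
  (forall q, (size q <= n)%N -> c (p * q) = 0) -> p = P n.
Proof.
move=> lc pc oP /monic_sizeP[sp pn] op.
have [sP Pn] := (monic_sizeP _ _).1 (oP.1 n).
have sD : (size (p - P n)%R <= n)%N by apply: size_sub_top => //; rewrite pn Pn.
apply/eqP; rewrite -subr_eq0; apply: contraT => /pc.
rewrite expr2 {1}mulrBl functionalB// op// (monic_orthogonal_lower lc oP)//.
by rewrite subrr ltxx.
Qed.

End OrthogonalPolynomials.

(** * Two functionals linked by multiplication by ['X - xi] *)

Section ChristoffelModification.
Context {R : realType} (c0 c1 : {poly R} -> R) (xi : R) (P T : nat -> {poly R}).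
Hypothesis lc0 : scalar c0.
Hypotheses (lc1 : scalar c1) (pc1 : positive_definite c1).
Hypothesis c01 : forall p, c1 (('X - xi%:P) * p) = c0 p.
Hypotheses (oP : monic_orthogonal c0 P) (oT : monic_orthogonal c1 T).

(** In the application [c0] is the Laguerre functional with parameter [alpha + 1], not the first
    functional of the coherent pair. Since [0.-1 = 0], only [0 < n] is meaningful. *)
Let ratio n := c1 (P n) / c1 (P n.-1).

Lemma divp_XsubC_spec (q : {poly R}) : exists2 r,
  q = q.[xi]%:P + ('X - xi%:P) * r & size r = (size q).-1.
Proof.
exists (q %/ ('X - xi%:P)); last first.
  by rewrite size_divp ?polyXsubC_eq0// size_XsubC subn1.
by rewrite {1}(divp_eq q ('X - xi%:P)) modp_XsubC addrC mulrC.
Qed.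

(* [c1 (P n) * (P n).[xi] = c1 (P n ^+ 2)], since [P n - (P n).[xi]] is
   divisible by ['X - xi] and [P n] is [c0]-orthogonal to the quotient. *)
Lemma modified_orthogonal_neq0 n : c1 (P n) != 0.
Proof.
have [mP sP] := oP.1 n.
have [r Pr sr] := divp_XsubC_spec (P n).
have : 0 < c1 (P n ^+ 2) by rewrite pc1// monic_neq0.
rewrite expr2 {2}Pr mulrDr functionalD// mulrCA c01.
rewrite (monic_orthogonal_lower lc0 oP) ?addr0 ?sr ?sP//.
rewrite mulrC mul_polyC functionalZ//.
by apply: contraTneq => ->; rewrite mulr0 ltxx.
Qed.

Lemma modified_orthogonalE n : (0 < n)%N ->
  T n = P n - ratio n *: P n.-1.
Proof.
case: n => // n _; apply/esym; rewrite /ratio /=; set s := _ / _.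
have [sP Pn] := (monic_sizeP _ _).1 (oP.1 n.+1).
have sPn := (oP.1 n).2.
apply: (monic_orthogonal_unique lc1 pc1 oT) => [|q sq].
  apply/monic_sizeP; split.
    rewrite (leq_trans (size_polyD _ _))// geq_max sP size_polyN.
    by rewrite (leq_trans (size_scale_leq _ _))// sPn.
  by rewrite coefB coefZ Pn [X in _ - _ * X]nth_default ?sPn// mulr0 subr0.
(* The choice of [s] kills the constant part [q.[xi]]; the part divisible by ['X - xi%:P] passes to
   [c0], where [P n.+1] and [P n] are both orthogonal to [r], of size at most [n]. *)
have [r qE sr] := divp_XsubC_spec q.
have srn : (size r <= n)%N by rewrite sr -subn1 leq_subLR add1n.
rewrite qE mulrDr functionalD// mulrCA c01 mulrC mul_polyC functionalZ//.
rewrite functionalB// functionalZ// divfK ?modified_orthogonal_neq0//.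
rewrite subrr mulr0 add0r mulrBl -scalerAl functionalB// functionalZ//.
by rewrite !(monic_orthogonal_lower lc0 oP) ?mulr0 ?subrr// ltnW.
Qed.

Lemma modified_sqnorm n : (0 < n)%N ->
  sqnorm c1 T n = - sqnorm c0 P n.-1 * ratio n.
Proof.
move=> n0; have TE := modified_orthogonalE n0.
case: n n0 TE => // n _ /= TE; rewrite /sqnorm expr2.
have [sT Tn] := (monic_sizeP _ _).1 (oT.1 n.+1).
have sXP : size (('X - xi%:P) * P n) = n.+2.
  by rewrite size_monicM ?monicXsubC ?(monic_neq0 (oP.1 n).1)// size_XsubC (oP.1 n).2.
have XPn : (('X - xi%:P) * P n)`_n.+1 = 1.
  have /monicP : ('X - xi%:P) * P n \is monic by rewrite monicMl ?monicXsubC ?(oP.1 n).1.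
  by rewrite lead_coefE sXP.
(* One factor [T n.+1] may be replaced by [('X - xi%:P) * P n]: both are monic of degree [n.+1], so
   their difference is orthogonal to [T n.+1]. *)
rewrite -{2}(subrK (('X - xi%:P) * P n) (T n.+1)) mulrDr functionalD//.
rewrite (monic_orthogonal_lower lc1 oT) ?add0r; last first.
  by apply: size_sub_top; rewrite ?sXP// Tn XPn.
rewrite mulrCA c01 TE mulrBl functionalB// -scalerAl functionalZ// oP.2; last first.
  by move=> /esym/n_Sn.
by rewrite expr2 /=; ring.
Qed.

Lemma sqnorm0 : sqnorm c1 T 0%N = c1 1.
Proof.
have [sT T0] := (monic_sizeP _ _).1 (oT.1 0%N).
by rewrite /sqnorm (size1_polyC sT) T0 expr1n.
Qed.

(** The coefficient is unique because [P n.-1] is nonzero. *)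
Lemma modified_coefP n s : (0 < n)%N ->
  T n = P n - s *: P n.-1 <-> s = ratio n.
Proof.
move=> n0; rewrite modified_orthogonalE//; split=> [/addrI/oppr_inj/eqP|->//].
rewrite -subr_eq0 -scalerBl scaler_eq0 (negbTE (monic_neq0 (oP.1 n.-1).1)) orbF.
by rewrite subr_eq0 => /eqP.
Qed.

End ChristoffelModification.

Local Open Scope classical_set_scope.
Local Open Scope ring_scope.

(** * The Gamma integral *)

Section GammaIntegral.
Context {R : realType}.
Local Notation mu := (@lebesgue_measure R).
Local Notation D := (`]0%R, +oo[%classic : set R).
Implicit Types (a x : R).

Definition laguerre_weight a x : R := x `^ a * expR (- x).

(** This is [Gamma (a + 1)], kept in the extended reals so that limits can be taken before
    finiteness is known. *)
Definition gamma_integral a : \bar R :=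
  (\int[mu]_(x in D) (laguerre_weight a x)%:E)%E.

Lemma laguerre_weight_ge0 a x : 0 <= laguerre_weight a x.
Proof. by rewrite mulr_ge0 ?powR_ge0 ?expR_ge0. Qed.

Lemma measurable_laguerre_weight a (A : set R) :
  measurable_fun A (laguerre_weight a).
Proof.
apply: measurable_funTS; apply: measurable_funM; first exact: measurable_powR.
by apply: measurableT_comp => //; exact: measurable_funN.
Qed.

Lemma is_derive_laguerre_weight a x : 0 < x ->
  is_derive x 1 (laguerre_weight (a + 1))
    ((a + 1) * laguerre_weight a x - laguerre_weight (a + 1) x).
Proof.
move=> x0.
have dp : is_derive x 1 (@powR R ^~ (a + 1)) ((a + 1) * x `^ a).
  by have := is_derive1_powR (a + 1) x0; rewrite addrK.
have de : is_derive x 1 (fun z => expR (- z)) (- expR (- x)).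
  by apply: is_derive_eq; rewrite mulrN1.
apply: is_derive_eq (is_deriveM dp de) _.
by rewrite /laguerre_weight /GRing.scale/=; ring.
Qed.

Lemma continuous_laguerre_weight a x : 0 < x -> {for x, continuous (laguerre_weight a)}.
Proof.
move=> x0; apply: differentiable_continuous; apply/derivable1_diffP.
by have := is_derive_laguerre_weight (a - 1) x0; rewrite subrK => -[].
Qed.

(** Compact intervals exhausting the open half-line. Starting at 2 makes them nondegenerate already
    for [n = 0]. *)
Let I (n : nat) : set R := `[n.+2%:R^-1, n.+2%:R].

Let I_lt n : n.+2%:R^-1 < n.+2%:R :> R.
Proof. by rewrite (@lt_trans _ _ 1)// ?invf_lt1// ltr1n. Qed.

Let ID n : I n `<=` D.
Proof.
move=> x; rewrite /I /= in_itv /= in_itv /= andbT => /andP[x0 _].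
by apply: lt_le_trans x0; rewrite invr_gt0.
Qed.

Let I_nd : nondecreasing_seq I.
Proof.
move=> m n mn; apply/subsetPset; apply: subset_itv; rewrite bnd_simp.
  by rewrite lef_pV2 ?posrE// ler_nat.
by rewrite ler_nat.
Qed.

Let bigcup_I : \bigcup_n I n = D.
Proof.
apply/seteqP; split=> [x [n _ /ID//]|x /=]; rewrite in_itv/= andbT => x0.
exists (maxn (Num.truncn x) (Num.truncn x^-1)) => //; rewrite /I /= in_itv/=.
apply/andP; split.
  rewrite -[leRHS]invrK lef_pV2 ?posrE ?invr_gt0//.
  by rewrite (le_trans (ltW (truncnS_gt _)))// ler_nat ltnS leqW// leq_maxr.
by rewrite (le_trans (ltW (truncnS_gt _)))// ler_nat ltnS leqW// leq_maxl.
Qed.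

Let cvg_I a : (\int[mu]_(x in I n) (laguerre_weight a x)%:E)%E @[n --> \oo] -->
  gamma_integral a.
Proof.
rewrite /gamma_integral -bigcup_I; apply: ge0_nondecreasing_set_cvg_integral => //.
- by move=> n; exact: measurable_itv.
- by move=> n; apply/measurable_EFinP; exact: measurable_laguerre_weight.
- by move=> n x _; rewrite lee_fin laguerre_weight_ge0.
Qed.

Let within_I a n : {within I n, continuous (laguerre_weight a)}.
Proof.
apply: continuous_in_subspaceT => x /set_mem /ID /=.
by rewrite in_itv/= andbT; exact: continuous_laguerre_weight.
Qed.

Let integrable_I a n : mu.-integrable (I n) (EFin \o laguerre_weight a).
Proof. by apply: continuous_compact_integrable => //; exact: segment_compact. Qed.

(** Integrates the derivative of [laguerre_weight (a + 1)] over [I n]; the last term collects the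
    boundary values. *)
Let laguerre_weight_I a n :
  ((a + 1)%:E * \int[mu]_(x in I n) (laguerre_weight a x)%:E =
   \int[mu]_(x in I n) (laguerre_weight (a + 1) x)%:E +
   (laguerre_weight (a + 1) n.+2%:R - laguerre_weight (a + 1) n.+2%:R^-1)%:E)%E.
Proof.
have mI : measurable (I n) by exact: measurable_itv.
have i0 x : n.+2%:R^-1 <= x -> 0 < x by apply: lt_le_trans; rewrite invr_gt0.
pose f x := (a + 1) * laguerre_weight a x - laguerre_weight (a + 1) x.
have := @continuous_FTC2 R f (laguerre_weight (a + 1)) _ _ (I_lt n).
rewrite EFinB => <-.
- have iZ : mu.-integrable (I n) (EFin \o (fun x => (a + 1) * laguerre_weight a x)).
    exact: integrableZl (integrable_I a n).
  have -> : (\int[mu]_(x in I n) (f x)%:E =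
     (a + 1)%:E * \int[mu]_(x in I n) (laguerre_weight a x)%:E -
     \int[mu]_(x in I n) (laguerre_weight (a + 1) x)%:E)%E.
    rewrite -integralZl//; last exact: integrable_I.
    under [X in _ = (X - _)%E]eq_integral do rewrite -EFinM.
    by rewrite -integralB_EFin.
  rewrite addeC subeK//; by apply: integrable_fin_num => //; exact: integrable_I.
- move=> x; apply: cvgB; last exact: within_I.
  apply: cvgM; [exact: cvg_cst|exact: within_I].
- split.
  + move=> x; rewrite in_itv/= => /andP[/ltW/i0 x0 _].
    by have [] := is_derive_laguerre_weight a x0.
  + by apply: cvg_at_right_filter; apply: continuous_laguerre_weight.
  + by apply: cvg_at_left_filter; apply: continuous_laguerre_weight.
- move=> x; rewrite in_itv/= => /andP[/ltW/i0 x0 _].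
  by rewrite derive1E; have [] := is_derive_laguerre_weight a x0.
Qed.

Lemma powR_le_exprn a x m : a <= m%:R -> 1 <= x -> x `^ a <= x ^+ m.
Proof.
by move=> am x1; rewrite -powR_mulrn ?(le_trans ler01)// ler_powR.
Qed.

(** With [a <= m], the bound [expR x >= x ^+ m.+1 / m.+1]![leaves one spare power of]x = n +
    2[, so the weight is at most]m.+1[! / (n + 1)]. *)
Let cvg_top a : laguerre_weight a n.+2%:R @[n --> \oo] --> 0.
Proof.
pose m := (Num.truncn a).+1.
have am : a <= m%:R by rewrite ltW// truncnS_gt.
apply: (@squeeze_cvgr _ _ _ _ (cst 0) (fun n => m.+1`!%:R * harmonic n)); last 2 first.
- exact: cvg_cst.
- by rewrite -[X in _ --> X](mulr0 m.+1`!%:R); apply: cvgM; [exact: cvg_cst|exact: cvg_harmonic].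
near=> n; rewrite laguerre_weight_ge0/= /laguerre_weight expRN.
set x : R := n.+2%:R; have x1 : 1 <= x by rewrite ler1n.
have x0 : 0 < x by rewrite (lt_le_trans ltr01).
rewrite ler_pdivrMr ?expR_gt0//.
rewrite (le_trans (powR_le_exprn am x1))//.
have F0 : 0 < m.+1`!%:R :> R by rewrite ltr0n fact_gt0.
have /le_trans : m.+1`!%:R * (harmonic n * (x ^+ m.+1 / m.+1`!%:R)) >= x ^+ m.
  rewrite mulrCA [X in harmonic n * X]mulrC divfK ?gt_eqF// exprS mulrA.
  rewrite ler_peMl ?exprn_ge0 ?(ltW x0)//= ler_pdivlMl// mulr1 ler_nat//.
apply; rewrite -[leRHS]mulrA; apply: ler_wpM2l; [exact: ltW|apply: ler_wpM2l].
  by rewrite invr_ge0.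
by apply: le_trans (expR_ge1Dxn m (ltW x0)); rewrite lerDr.
Unshelve. all: by end_near. Qed.

Let cvg_bot a : 0 < a -> laguerre_weight a n.+2%:R^-1 @[n --> \oo] --> 0.
Proof.
move=> a0.
suff : laguerre_weight a x @[x --> 0^'+] --> 0.
  move=> /cvg_at_rightP; apply; split => [n|]; first by rewrite invr_gt0.
  by have := @cvg_harmonic R; rewrite -cvg_shiftS.
rewrite -[X in _ --> X](mul0r (expR (- 0))); apply: cvgM; first exact: powR_cvg0.
apply: cvg_at_right_filter; apply: continuous_comp; first exact: continuousN.
exact: continuous_expR.
Qed.

(* The fundamental theorem of calculus on the compact intervals [I n], followed
   by monotone convergence in the extended reals; finiteness of the integrals
   is then a consequence, starting from natural exponents. *)
Lemma gamma_integralS a : -1 < a ->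
  ((a + 1)%:E * gamma_integral a = gamma_integral (a + 1))%E.
Proof.
move=> a1; have b0 : 0 < a + 1 by rewrite -ltrBlDr sub0r.
have l : (\int[mu]_(x in I n) (laguerre_weight (a + 1) x)%:E +
   (laguerre_weight (a + 1) n.+2%:R - laguerre_weight (a + 1) n.+2%:R^-1)%:E)%E @[n --> \oo]
    --> ((a + 1)%:E * gamma_integral a)%E.
  by under eq_fun do rewrite -laguerre_weight_I; exact: cvgeZl.
rewrite -(cvg_lim _ l)//; apply: cvg_lim => //.
(* The boundary terms have the finite limit 0, so the sum of the limits is defined even if the
   integral were infinite. *)
rewrite -[X in _ --> X]adde0; apply: cvgeD => //; first by rewrite fin_num_adde_defl.
apply: cvg_EFin; first exact: nearW.
rewrite -(subrr 0); apply: cvgB; [exact: cvg_top|exact: cvg_bot].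
Qed.

(** For exponent 0 the weight is the exponential density of rate 1, of total mass 1; the functional
    equation gives the induction step. *)
Let gamma_integral_nat n : (gamma_integral n%:R < +oo)%E.
Proof.
elim: n => [|n ih]; last first.
  rewrite -natr1 -gamma_integralS ?lte_mul_pinfty ?lee_fin ?ler0n//.
  by rewrite (lt_le_trans _ (ler0n _ n))// ltrN10.
have eE x : D x -> laguerre_weight 0 x = exponential_pdf 1 x.
  rewrite /= in_itv/= andbT => x0.
  by rewrite exponential_pdfE ?(ltW x0)// /laguerre_weight powRr0 mulN1r.
apply: (@le_lt_trans _ _ 1%E); last by rewrite ltry.
rewrite -(@integral_exponential_pdf R 1)// /gamma_integral.
under eq_integral => x /set_mem /eE -> do [].
apply: ge0_subset_integral => //.
  by apply/measurable_EFinP; exact: measurable_exponential_pdf.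
by move=> x _; rewrite lee_fin exponential_pdf_ge0.
Qed.

(** For [b >= 0], [x ^ b <= 1 + x ^ m] with a natural [m >= b], by comparing [x] with 1. In general
    the functional equation carries finiteness from [a + 1 > 0] back to [a]. *)
Lemma gamma_integral_lty a : -1 < a -> (gamma_integral a < +oo)%E.
Proof.
have H b : 0 <= b -> (gamma_integral b < +oo)%E.
  move=> b0; pose m := (Num.truncn b).+1.
  have bm : b <= m%:R by rewrite ltW// truncnS_gt.
  apply: (@le_lt_trans _ _ (gamma_integral 0 + gamma_integral m%:R)%E).
    have mw c : measurable_fun D (EFin \o laguerre_weight c).
      by apply/measurable_EFinP; exact: measurable_laguerre_weight.
    have w0 c x : D x -> (0 <= (laguerre_weight c x)%:E)%E.
      by rewrite lee_fin laguerre_weight_ge0.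
    have wD : (gamma_integral 0 + gamma_integral m%:R =
        \int[mu]_(x in D) ((laguerre_weight 0 x)%:E + (laguerre_weight m%:R x)%:E))%E.
      by rewrite ge0_integralD//; [move=> x; apply: w0|exact: mw|move=> x; apply: w0|exact: mw].
    rewrite wD; apply: ge0_le_integral => //.
    - by move=> x; apply: w0.
    - exact: mw.
    - by apply: emeasurable_funD; exact: mw.
    move=> x; rewrite /= in_itv/= andbT => x0; rewrite -EFinD lee_fin.
    rewrite /laguerre_weight -mulrDl ler_wpM2r ?expR_ge0// powRr0.
    have [x1|/ltW x1] := leP x 1; last first.
      by rewrite (le_trans (ler_powR x1 bm))// lerDr.
    rewrite -[leLHS]addr0 lerD ?powR_ge0//.
    by rewrite -(powRr0 x) ger_powR// x0.
  apply: lte_add_pinfty; last exact: gamma_integral_nat.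
  exact: (gamma_integral_nat 0%N).
move=> a1; have b0 : 0 < a + 1 by rewrite -ltrBlDr sub0r.
have := H _ (ltW b0); rewrite -gamma_integralS//.
have : (0 <= gamma_integral a)%E.
  by apply: integral_ge0 => x _; rewrite lee_fin laguerre_weight_ge0.
case: (gamma_integral a) => //= [r _ _|_]; first by rewrite ltry.
by rewrite gt0_muley ?lte_fin.
Qed.

Lemma integrable_laguerre_weight a : -1 < a ->
  mu.-integrable D (EFin \o laguerre_weight a).
Proof.
move=> a1; apply/integrableP; split.
  by apply/measurable_EFinP; exact: measurable_laguerre_weight.
under eq_integral do rewrite /= ger0_norm ?laguerre_weight_ge0//.
exact: gamma_integral_lty.
Qed.

Lemma laguerre_weightM a n x : 0 < x ->
  x ^+ n * laguerre_weight a x = laguerre_weight (a + n%:R) x.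
Proof.
move=> x0; rewrite /laguerre_weight powRD; last by rewrite (gt_eqF x0) implybT.
by rewrite powR_mulrn ?(ltW x0)//; ring.
Qed.

End GammaIntegral.

(** * Functionals given by a weight on the positive half-line *)

(** Linear factors are split off by induction on the size; whether a root remains is decided
    classically. *)
Lemma poly_roots_finite (F : idomainType) (p : {poly F}) : p != 0 ->
  exists s : seq F, forall x, root p x -> x \in s.
Proof.
move=> p0; have [n] := ubnP (size p); elim: n => // n IH in p p0 *.
rewrite ltnS => sp; have [[x /factor_theorem[q pE]]|nr] := pselect (exists x, root p x).
  have q0 : q != 0 by apply: contraNneq p0 => q0; rewrite pE q0 mul0r.
  have [|s hs] := IH q q0.
    by apply: leq_trans sp; rewrite pE size_Mmonic ?monicXsubC// size_XsubC addn2.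
  exists (x :: s) => y; rewrite pE rootM root_XsubC in_cons orbC.
  by case/orP => [->//|/hs ->]; rewrite orbT.
by exists [::] => x rx; exfalso; apply: nr; exists x.
Qed.

Section WeightFunctional.
Context {R : realType} (w : R -> R).
Local Notation mu := (@lebesgue_measure R).
Local Notation D := (`]0%R, +oo[%classic : set R).
Hypothesis iw : forall n, mu.-integrable D (EFin \o (fun x => x ^+ n * w x)).

Definition weight_functional (p : {poly R}) : R :=
  \int[mu]_(x in `]0, +oo[) (p.[x] * w x).

Lemma integrable_horner_weight (p : {poly R}) :
  mu.-integrable D (EFin \o (fun x => p.[x] * w x)).
Proof.
have H : mu.-integrable D (fun x => \sum_(i <- iota 0 (size p)) (p`_i)%:E * (x ^+ i * w x)%:E)%E.
  by apply: integrable_sum => // i _; apply: integrableZl => //; exact: iw.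
apply: eq_integrable H => // x _ /=.
under eq_bigr do rewrite -EFinM mulrA.
rewrite sumEFin -mulr_suml horner_coef.
by rewrite -[X in \sum_(_ <- iota 0 X) _]subn0 -/(index_iota _ _) big_mkord.
Qed.

Lemma weight_functional_scalar : scalar weight_functional.
Proof.
move=> a p q; rewrite /weight_functional.
rewrite -RintegralZl//; last exact: integrable_horner_weight.
rewrite -RintegralD//; last exact: integrable_horner_weight.
  by apply: eq_Rintegral => x _; rewrite hornerD hornerZ mulrDl mulrA.
have := integrable_horner_weight (a *: p).
by apply: eq_integrable => // x _ /=; rewrite hornerZ mulrA.
Qed.

(** If the integral were 0, the nonnegative integrand would vanish almost everywhere. As [w > 0],
    the half-line would lie in a null set together with the finitely many roots of [p ^+ 2],
    contradicting its infinite measure. *)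
Lemma weight_functional_pos : (forall x, 0 < x -> 0 < w x) ->
  positive_definite weight_functional.
Proof.
move=> w0 p p0; have p20 := expf_neq0 2 p0.
have ip := integrable_horner_weight (p ^+ 2).
have ge0 x : D x -> 0 <= (p ^+ 2).[x] * w x.
  by rewrite /= in_itv/= andbT => /w0/ltW wx; rewrite horner_exp mulr_ge0// sqr_ge0.
rewrite lt_neqAle Rintegral_ge0// andbT eq_sym; apply/eqP => E.
have : ae_eq mu D (EFin \o (fun x => (p ^+ 2).[x] * w x)) (cst 0%E).
  apply/ae_eq_integral_abs => //; first exact: measurable_int ip.
  transitivity (\int[mu]_(x in D) ((p ^+ 2).[x] * w x)%:E)%E.
    by apply: eq_integral => x /set_mem /ge0 px /=; rewrite ger0_norm.
  rewrite -[LHS]fineK; last exact: integrable_fin_num ip.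
  by congr EFin.
move=> [N [mN N0 DN]].
have [s hs] := poly_roots_finite p20.
have cs : countable [set` s] := finite_set_countable (finite_seq s).
have ms : measurable [set` s] by apply: countable_measurable cs => t; exact: measurable_set1.
have D0 : mu D = 0.
  apply: (@subset_measure0 _ _ _ mu _ (N `|` [set` s])) => //.
  - by apply: measurableU.
  - move=> x Dx; have [rx|rx] := boolP (root (p ^+ 2) x).
      by right; exact: hs.
    left; apply: DN => /= /(_ Dx)/eqP.
    rewrite eqe mulf_eq0 -rootE (negbTE rx)/=.
    by move: Dx; rewrite /= in_itv/= andbT => /w0/gt_eqF ->.
  - by apply: null_set_setU => //; exact: countable_lebesgue_measure0.
by move: D0; rewrite lebesgue_measure_itv/= ltry.
Qed.

End WeightFunctional.

(** * Laguerre functionals and their modification *)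

Section LaguerreFunctional.
Context {R : realType}.
Local Notation mu := (@lebesgue_measure R).
Local Notation D := (`]0%R, +oo[%classic : set R).
Implicit Types (a alpha xi M x : R) (p q : {poly R}).

Let Dgt0 x : D x -> 0 < x. Proof. by rewrite /= in_itv/= andbT. Qed.

Lemma laguerre_weight_gt0 a x : 0 < x -> 0 < laguerre_weight a x.
Proof. by move=> x0; rewrite mulr_gt0 ?powR_gt0 ?expR_gt0. Qed.

Lemma ltN1D1 a : -1 < a -> -1 < a + 1.
Proof. lra. Qed.

Lemma integrable_laguerre_moment a n : -1 < a ->
  mu.-integrable D (EFin \o (fun x => x ^+ n * laguerre_weight a x)).
Proof.
move=> a1; have an1 : -1 < a + n%:R by rewrite ltr_wpDr ?ler0n.
apply: eq_integrable (integrable_laguerre_weight an1) => // x /set_mem/Dgt0 x0 /=.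
by rewrite laguerre_weightM.
Qed.

Lemma laguerre_functional_scalar a : -1 < a -> scalar (laguerre_functional a).
Proof.
move=> a1; apply: (@weight_functional_scalar R (laguerre_weight a)) => n.
exact: integrable_laguerre_moment.
Qed.

Lemma laguerre_functional_pos a : -1 < a ->
  positive_definite (laguerre_functional a).
Proof.
move=> a1; apply: (@weight_functional_pos R (laguerre_weight a)) => [n|x].
  exact: integrable_laguerre_moment.
exact: laguerre_weight_gt0.
Qed.

Lemma laguerre_functionalMX a p : -1 < a ->
  laguerre_functional (a + 1) p = laguerre_functional a ('X * p).
Proof.
move=> a1; apply: eq_Rintegral => x /set_mem/Dgt0 x0.
rewrite -!/(laguerre_weight _ _) -(laguerre_weightM a 1 x0).
by rewrite hornerM hornerX; ring.
Qed.

Lemma laguerre_functionalXn a n :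
  laguerre_functional a 'X^n = fine (gamma_integral (a + n%:R)).
Proof.
congr fine; apply: eq_integral => x /set_mem/Dgt0 x0.
by rewrite hornerXn -/(laguerre_weight _ _) laguerre_weightM.
Qed.

(* Integration of [(p(x) x^(a+1) e^-x)'], which reduces on monomials to the
   functional equation of the Gamma function. *)
Lemma laguerre_functional_deriv a p : -1 < a ->
  laguerre_functional (a + 1) p^`() =
  laguerre_functional (a + 1) p - (a + 1) * laguerre_functional a p.
Proof.
move=> a1; have a2 := ltN1D1 a1.
have l1 := laguerre_functional_scalar a1; have l2 := laguerre_functional_scalar a2.
rewrite -[p]coefK poly_def.
elim/big_rec: _ => [|i q _ IH]; first by rewrite deriv0 !functional0// mulr0 subr0.
rewrite derivD derivZ !functionalD// IH !functionalZ// derivXn.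
suff -> : laguerre_functional (a + 1) ('X^(i.-1) *+ i) =
   laguerre_functional (a + 1) 'X^i - (a + 1) * laguerre_functional a 'X^i by ring.
rewrite laguerre_functionalMX// -mulr_natl mulrCA.
(* For [i = 0], where [i.-1 = 0], the factor [i%:R] makes both sides vanish. *)
have -> : i%:R * ('X * 'X^(i.-1)) = (i%:R : R) *: 'X^i :> {poly R}.
  by case: (nat_of_ord i) => [|j]; rewrite ?mul0r ?scale0r// -exprS mulr_natl scaler_nat.
rewrite functionalZ// laguerre_functionalMX// -exprS !laguerre_functionalXn.
have ai1 : -1 < a + i%:R by rewrite ltr_wpDr ?ler0n.
rewrite -natr1 addrA -(gamma_integralS ai1) fineM//; last first.
  exact: (integrable_fin_num _ (integrable_laguerre_weight ai1)).
by rewrite /=; ring.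
Qed.

(** By uniqueness it suffices to test against [q] of degree below [n]. Writing
    [P' q = (P q)' - P q'] and integrating by parts leaves only pairings under parameter [alpha] of
    [P] with [q], ['X * q] and ['X * q'], all of degree at most [n], while [P] has degree [n.+1]. *)
Lemma laguerre_deriv (L : R -> nat -> {poly R}) alpha n : -1 < alpha ->
  (forall a, -1 < a -> monic_orthogonal (laguerre_functional a) (L a)) ->
  (n.+1%:R)^-1 *: (L alpha n.+1)^`() = L (alpha + 1) n.
Proof.
move=> a1 oL; have a2 := ltN1D1 a1.
have l1 := laguerre_functional_scalar a1; have l2 := laguerre_functional_scalar a2.
have [sL Ln] := (monic_sizeP _ _).1 ((oL _ a1).1 n.+1).
have n0 : n.+1%:R != 0 :> R by rewrite pnatr_eq0.
apply: (monic_orthogonal_unique l2 (laguerre_functional_pos a2) (oL _ a2)).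
  apply/monic_sizeP; split; last by rewrite coefZ coef_deriv Ln mulVf.
  rewrite (leq_trans (size_scale_leq _ _))// -ltnS (leq_trans _ sL)//.
  by rewrite lt_size_deriv// monic_neq0// ((oL _ a1).1 n.+1).1.
move=> q sq; set P := L alpha n.+1.
rewrite -scalerAl functionalZ//.
have -> : P^`() * q = (P * q)^`() - P * q^`() by rewrite derivM addrK.
rewrite functionalB// laguerre_functional_deriv// !laguerre_functionalMX//.
rewrite !(mulrCA 'X).
have sX (r : {poly R}) : (size r <= n)%N -> (size ('X * r)%R <= n.+1)%N.
  by move=> sr; rewrite (leq_trans (size_polyMleq _ _))// size_polyX.
have sq' : (size q^`() <= n)%N.
  have [->|q0] := eqVneq q 0; first by rewrite deriv0 size_poly0.
  by rewrite (leq_trans (ltnW (lt_size_deriv q0))).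
have oP (r : {poly R}) : (size r <= n.+1)%N -> laguerre_functional alpha (P * r) = 0.
  exact: (monic_orthogonal_lower l1 (oL _ a1)).
by rewrite !oP ?sX//; [ring|exact: leqW].
Qed.

Let modified_weight alpha xi x : R := x `^ (alpha + 1) / (x - xi) * expR (- x).

(** Since [xi <= 0] gives [x <= x - xi], the modified weight is dominated by the Laguerre weight
    with parameter [alpha]. *)
Lemma integrable_modified_moment alpha xi n : -1 < alpha -> xi <= 0 ->
  mu.-integrable D (EFin \o (fun x => x ^+ n * modified_weight alpha xi x)).
Proof.
move=> a1 xi0; have a2 := ltN1D1 a1.
apply: le_integrable (integrable_laguerre_moment n a1) => //.
  apply/measurable_EFinP; apply: open_continuous_measurable_fun => //.
  move=> x /set_mem/Dgt0 x0; apply: (@continuousM _ _ (fun x => x ^+ n)).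
    exact: exprn_continuous.
  have -> : modified_weight alpha xi =
      (fun x => laguerre_weight (alpha + 1) x * (x - xi)^-1).
    by apply/funext => y; rewrite /modified_weight /laguerre_weight; ring.
  apply: continuousM; first exact: continuous_laguerre_weight.
  apply: continuousV; first by rewrite gt_eqF// subr_gt0 (le_lt_trans xi0).
  by apply: continuousB => //; exact: cst_continuous.
move=> x /Dgt0 x0 /=; rewrite lee_fin.
have xxi : 0 < x - xi by rewrite subr_gt0 (le_lt_trans xi0).
rewrite !ger0_norm; last 2 first.
- by rewrite mulr_ge0 ?laguerre_weight_ge0 ?exprn_ge0// ltW.
- by rewrite mulr_ge0 ?exprn_ge0 ?(ltW x0)// ?mulr_ge0 ?invr_ge0 ?powR_ge0 ?expR_ge0 ?(ltW xxi).
rewrite ler_wpM2l ?exprn_ge0 ?(ltW x0)// /modified_weight /laguerre_weight.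
rewrite ler_wpM2r ?expR_ge0// ler_pdivrMr// powRD; last by rewrite (gt_eqF x0) implybT.
by rewrite powRr1 ?(ltW x0)// ler_wpM2l ?powR_ge0// lerDl oppr_ge0.
Qed.

Lemma modified_functionalE alpha xi M p : modified_functional alpha xi M p =
  weight_functional (modified_weight alpha xi) p + M * p.[xi].
Proof. by []. Qed.

Lemma modified_functional_scalar alpha xi M : -1 < alpha -> xi <= 0 ->
  scalar (modified_functional alpha xi M).
Proof.
move=> a1 xi0 k p q; rewrite !modified_functionalE.
rewrite weight_functional_scalar; last first.
  by move=> n; exact: integrable_modified_moment.
by rewrite hornerD hornerZ; ring.
Qed.

Lemma modified_functional_pos alpha xi M : -1 < alpha -> xi <= 0 -> 0 <= M ->
  positive_definite (modified_functional alpha xi M).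
Proof.
move=> a1 xi0 M0 p p0; rewrite modified_functionalE ltr_wpDr//.
  by rewrite horner_exp mulr_ge0// sqr_ge0.
apply: weight_functional_pos p0 => [n|x x0].
  exact: integrable_modified_moment.
by rewrite mulr_gt0 ?expR_gt0// divr_gt0 ?powR_gt0// subr_gt0 (le_lt_trans xi0).
Qed.

(** The factor ['X - xi%:P] cancels the denominator of the weight and annihilates the mass at
    [xi]. *)
Lemma modified_functionalM alpha xi M p : xi <= 0 ->
  modified_functional alpha xi M (('X - xi%:P) * p) =
  laguerre_functional (alpha + 1) p.
Proof.
move=> xi0; rewrite modified_functionalE hornerM hornerXsubC subrr mul0r mulr0 addr0.
apply: eq_Rintegral => x /set_mem/Dgt0 x0.
have xxi : x - xi != 0 by rewrite gt_eqF// subr_gt0 (le_lt_trans xi0).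
by rewrite hornerM hornerXsubC /modified_weight; field.
Qed.

End LaguerreFunctional.

Local Close Scope classical_set_scope.

Theorem mainTheorem11 (R : realType) (alpha xi M : R)
    (L : R -> nat -> {poly R}) (T : nat -> {poly R}) :
  -1 < alpha -> xi <= 0 -> 0 <= M ->
  (forall a : R, -1 < a -> monic_orthogonal (laguerre_functional a) (L a)) ->
  let c1 := modified_functional alpha xi M in
  monic_orthogonal c1 T ->
  let k := fun (a : R) (n : nat) => sqnorm (laguerre_functional a) (L a) n in
  let khat := sqnorm c1 T in
  [/\ khat 0%N = c1 1,
      (forall n : nat, (0 < n)%N -> c1 (L (alpha + 1) n.-1) != 0),
      (forall n : nat, (0 < n)%N ->
         khat n = - k (alpha + 1) n.-1 *
                  (c1 (L (alpha + 1) n) / c1 (L (alpha + 1) n.-1)))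
    & (forall (n : nat) (s : R), (0 < n)%N ->
         coherence_coef (L alpha) T n s <->
         s = c1 (L (alpha + 1) n) / c1 (L (alpha + 1) n.-1))].
Proof.
move=> a1 xi0 M0 oL c1 oT k khat; have a2 := ltN1D1 a1.
have lc0 := laguerre_functional_scalar a2.
have lc1 := modified_functional_scalar M a1 xi0.
have pc1 := modified_functional_pos a1 xi0 M0.
have c01 p := modified_functionalM alpha M p xi0.
have oP := oL _ a2.
split.
- exact: sqnorm0 oT.
- by move=> n _; exact: (modified_orthogonal_neq0 lc0 lc1 pc1 c01 oP).
- by move=> n; exact: (modified_sqnorm lc0 lc1 pc1 c01 oP oT).
(* Both normalized derivatives become Laguerre polynomials with parameter [alpha + 1], so coherence
   reduces to uniqueness of the coefficient. *)
- case=> // n s _; rewrite /coherence_coef !laguerre_deriv//.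
  exact: (modified_coefP lc0 lc1 pc1 c01 oP oT).
Qed.
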